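(* Let $n, k \geq 1$ and let $r \geq 2$ be even. Then every $r$-uniform convex geometric hypergraph on $\Omega_n$ that contains no $k$-zigzag has at most $\frac{(k-1)(r-1)}{r}\binom{n}{r-1}$ edges; that is, $\mathrm{ex}_{\circlearrowright}(n,\mathsf{P}_k^r) \leq \frac{(k-1)(r-1)}{r}\binom{n}{r-1}$.
   Context: $\Omega_n$ is a set of $n$ points in strictly convex position in the plane, equipped with its cyclic (clockwise) ordering $\prec$. An $r$-uniform convex geometric hypergraph (cgh) on $\Omega_n$ is a set $H$ of $r$-element subsets of $\Omega_n$ (its edges). A segment of $\Omega_n$ is a set of consecutive points in the cyclic order; for disjoint segments we write $I_0 \prec I_1 \prec \dots \prec I_{r-1}$ if they appear in this order going once around clockwise, and each segment is linearly ordered by $\prec$ (clockwise from its first point). For $k \geq 1$ and even $r \geq 2$, a $k$-zigzag in $H$ is a sequence of distinct points $v_0, v_1, \dots, v_{k+r-2}$ of $\Omega_n$ such that $\{v_i,\dots,v_{i+r-1}\} \in H$ for all $0 \leq i < k$ (a tight $k$-path), and there exist disjoint segments $I_0 \prec I_1 \prec \dots \prec I_{r-1}$ of $\Omega_n$ with $\{v_i : i \equiv j \pmod r\} \subseteq I_j$ for $0 \le j < r$, such that (i) if $j$ is even then $v_j \prec v_{j+r} \prec v_{j+2r} \prec \cdots$ within $I_j$, and (ii) if $j$ is odd then $v_j \succ v_{j+r} \succ v_{j+2r} \succ \cdots$ within $I_j$. $\mathrm{ex}_{\circlearrowright}(n,\mathsf P_k^r)$ is the maximum number of edges of an $r$-uniform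 cgh on $\Omega_n$ containing no $k$-zigzag. *)

(* Defs.v *)
From mathcomp Require Import all_boot all_order all_algebra.
From mathcomp Require Import boolp.

Set Implicit Arguments.
Unset Strict Implicit.
Unset Printing Implicit Defensive.

(* Omega_n is 'I_n, the points being numbered 0, ..., n-1 clockwise: the
   cyclic order is the only part of the plane geometry that is used. *)

(* Number of clockwise steps from a to x. *)
Definition cwdist (n : nat) (a x : 'I_n) : nat := (x + (n - a)) %% n.

(* x comes strictly before y when going once around clockwise from a. *)
Definition cwlt (n : nat) (a x y : 'I_n) : Prop := cwdist a x < cwdist a y.

(* S is a (nonempty) set of consecutive points with first point a; the linear
   order of such a segment is cwlt a. *)
Definition segment_from (n : nat) (a : 'I_n) (S : {set 'I_n}) : Prop :=
  exists2 l : nat, 0 < l <= n & S = [set x | cwdist a x < l].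

(* I_0 < I_1 < ... < I_(r-1), where a j is the first point of I j: the turn
   around Omega_n starts at the first point of I_0. *)
Definition segments_in_order (n r : nat)
    (a : 'I_r -> 'I_n) (I : 'I_r -> {set 'I_n}) : Prop :=
  [/\ forall j, segment_from (a j) (I j),
      forall i j, i != j -> [disjoint I i & I j]
    & forall o i j : 'I_r, o = 0 :> nat -> i < j ->
        forall x y, x \in I i -> y \in I j -> cwlt (a o) x y].

Definition uniform_cgh (n r : nat) (H : {set {set 'I_n}}) : Prop :=
  forall e, e \in H -> #|e| = r.

(* Only the terms v 0, ..., v (k + r - 2) of v are relevant. *)
Definition tight_path (n r k : nat) (H : {set {set 'I_n}})
    (v : nat -> 'I_n) : Prop :=
  (forall i j, i < k + r - 1 -> j < k + r - 1 -> v i = v j -> i = j) /\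
  (forall i, i < k -> [set v (i + t) | t : 'I_r] \in H).

Definition zigzag (n r k : nat) (H : {set {set 'I_n}})
    (v : nat -> 'I_n) : Prop :=
  tight_path r k H v /\
  exists (a : 'I_r -> 'I_n) (I : 'I_r -> {set 'I_n}),
    [/\ segments_in_order a I,
        forall (j : 'I_r) i, i < k + r - 1 -> i %% r = j -> v i \in I j,
        forall (j : 'I_r) i, i + r < k + r - 1 -> i %% r = j -> ~~ odd j ->
          cwlt (a j) (v i) (v (i + r))
      & forall (j : 'I_r) i, i + r < k + r - 1 -> i %% r = j -> odd j ->
          cwlt (a j) (v (i + r)) (v i)].

Definition zigzag_free (n r k : nat) (H : {set {set 'I_n}}) : Prop :=
  ~ exists v, zigzag r k H v.

Definition ex_zigzag (n r k : nat) : nat :=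
  \max_(H : {set {set 'I_n}} | `[< uniform_cgh r H /\ zigzag_free r k H >])
    #|H|.

(* Main.v *)
Require Import Defs.
From mathcomp Require Import all_boot all_order all_algebra.
From mathcomp Require Import boolp zify.

(* Following Perles, mark in each edge e a point x to be replaced next; there
   are r |H| marked edges.  Such a pair is the cyclically ordered r-tuple of e
   starting at x, and it occupies a gap of the cyclically ordered (r-1)-tuple
   e - x; there are (r-1) C(n, r-1) such (r-1)-tuples.  A zigzag is extended by
   moving x inside its gap, clockwise and counterclockwise alternately, and then
   passing the mark to the next point of the edge.  Hence at each extension at
   most one marked edge per gap is lost, and if r |H| > (k-1) (r-1) C(n, r-1),
   some marked edge survives k-1 extensions.  The walk obtained in this way is a
   zigzag: each move takes place between the two neighbours of the moving point
   in the current edge, so that the r tracks, which run clockwise and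
   counterclockwise alternately, never cross. *)

Set Implicit Arguments.
Unset Strict Implicit.
Unset Printing Implicit Defensive.

Import GRing.Theory Num.Theory.

Section ClockwiseOrder.
Variable n : nat.
Implicit Types (a b p x y z : 'I_n) (s f : seq 'I_n).

Definition cwltb a : rel 'I_n := relpre (cwdist a) ltn.

Lemma cwdistE a x : cwdist a x = if a <= x then x - a else x + n - a.
Proof.
rewrite /cwdist; have an := ltn_ord a; have xn := ltn_ord x.
case: leqP => ax; last by rewrite modn_small; lia.
have -> : x + (n - a) = x - a + n by lia.
by rewrite modnDr modn_small; lia.
Qed.

Lemma ltn_cwdist a x : cwdist a x < n.
Proof. by rewrite ltn_mod (leq_ltn_trans _ (ltn_ord a)). Qed.

Lemma cwdistxx a : cwdist a a = 0.
Proof. by rewrite cwdistE leqnn subnn. Qed.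

Lemma cwdist_inj a : injective (cwdist a).
Proof.
move=> x y exy; apply: val_inj => /=; move: exy; rewrite !cwdistE.
have := ltn_ord a; have := ltn_ord x; have := ltn_ord y.
by case: (leqP a x) => ?; case: (leqP a y) => ?; lia.
Qed.

Lemma cwdist_surj a d : d < n -> exists x, cwdist a x = d.
Proof.
move=> dn; have n0 : 0 < n by apply: leq_ltn_trans dn.
exists (Ordinal (ltn_pmod (a + d) n0)); rewrite /cwdist /= modnDml.
by rewrite addnAC subnKC ?modnDl ?modn_small // ltnW.
Qed.

Lemma cwdist_rebase b a x : cwdist a x =
  if cwdist b a <= cwdist b x then cwdist b x - cwdist b a
  else cwdist b x + n - cwdist b a.
Proof.
rewrite !cwdistE; have := ltn_ord a; have := ltn_ord b; have := ltn_ord x.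
by case: (leqP b a) => ?; case: (leqP b x) => ?; case: (leqP a x) => ? *;
  case: leqP => ?; lia.
Qed.

Lemma cwltb_trans a : transitive (cwltb a).
Proof. by move=> y x z; apply: ltn_trans. Qed.

Lemma cwltb_irr a : irreflexive (cwltb a).
Proof. by move=> x; apply: ltnn. Qed.

Lemma cwltb_total a x y : x != y -> cwltb a x y || cwltb a y x.
Proof. by rewrite -neq_ltn; apply: contra_neq; apply: cwdist_inj. Qed.

Lemma cwltbx a x : cwltb a a x = (x != a).
Proof.
rewrite /cwltb /= cwdistxx lt0n; congr (~~ _); apply/eqP/eqP => [|->].
  by rewrite -(cwdistxx a) => /cwdist_inj.
exact: cwdistxx.
Qed.

Lemma cwltb_rebase b a x y :
  cwdist b a <= cwdist b x -> cwdist b a <= cwdist b y ->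
  cwltb a x y = cwltb b x y.
Proof. by move=> ax ay; rewrite /cwltb /= !(cwdist_rebase b a) ax ay; lia. Qed.

(* Here p and z are the neighbours of the moving point x; they coincide if the
   edges have only two points. *)
Lemma cwltb_advance b p x y z :
  cwltb b x z -> cwltb z p y -> cwltb p x y -> cwltb b x y && cwltb b y z.
Proof.
rewrite /cwltb /= !(cwdist_rebase b p) !(cwdist_rebase b z).
have := ltn_cwdist b x; have := ltn_cwdist b y.
have := ltn_cwdist b p; have := ltn_cwdist b z.
case: (leqP (cwdist b p) (cwdist b y)); case: (leqP (cwdist b p) (cwdist b x));
  case: (leqP (cwdist b z) (cwdist b y)) => ?;
  by case: (leqP (cwdist b z) (cwdist b p)); lia.
Qed.

Lemma cwltb_retreat b p x y :
  cwltb b p x -> y != p -> cwltb p y x -> cwltb b p y && cwltb b y x.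
Proof.
rewrite -cwltbx /cwltb /= cwdistxx !(cwdist_rebase b p).
have := ltn_cwdist b x; have := ltn_cwdist b y.
by case: (leqP (cwdist b p) (cwdist b y)) => ?;
  case: (leqP (cwdist b p) (cwdist b x)) => ?; lia.
Qed.

Definition cwltb_alt (rev : bool) a x y :=
  if rev then cwltb a y x else cwltb a x y.

Lemma cwltb_alt_trans rev a : transitive (cwltb_alt rev a).
Proof.
move=> y x z; case: rev => /= xy yz; last exact: cwltb_trans yz.
exact: cwltb_trans xy.
Qed.

Lemma cwltb_alt_irr rev a : irreflexive (cwltb_alt rev a).
Proof. by move=> x; case: rev; apply: cwltb_irr. Qed.

Lemma cwltb_alt_total rev a x y :
  x != y -> cwltb_alt rev a x y || cwltb_alt rev a y x.
Proof. by case: rev => xy; [rewrite orbC|]; apply: cwltb_total. Qed.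

Definition cyc_sorted s := if s is x :: _ then sorted (cwltb x) s else true.

Lemma cyc_sorted_behead s : cyc_sorted s -> cyc_sorted (behead s).
Proof.
case: s => [//|x [//|y f]] /= /andP[_ yf].
have /allP xyf := order_path_min (@cwltb_trans x) yf.
rewrite (@eq_in_path _ (mem (y :: f)) _ (cwltb x)) //; last exact/allP.
move=> z u; rewrite !inE => zf uf; apply: cwltb_rebase.
  by case/predU1P: zf => [->//|/xyf/ltnW].
by case/predU1P: uf => [->//|/xyf/ltnW].
Qed.

Lemma cyc_sorted_rot1 s : cyc_sorted s -> cyc_sorted (rot 1 s).
Proof.
case: s => [//|x [//|y f]] xyf; rewrite rot1_cons.
rewrite /= rcons_path (cyc_sorted_behead xyf : path _ _ _) /=.
move: xyf => /= /andP[xy /(order_path_min (@cwltb_trans x))/allP xf].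
have yl : cwdist x y <= cwdist x (last y f).
  by have := mem_last y f; rewrite inE => /predU1P[->|/xf/ltnW].
have := ltn_cwdist x (last y f); move: xy.
by rewrite /cwltb /= !(cwdist_rebase x y) yl cwdistxx; case: leqP; lia.
Qed.

Lemma cyc_sorted_nth x0 s i j : cyc_sorted s -> i < j < size s ->
  cwltb (nth x0 s 0) (nth x0 s i) (nth x0 s j).
Proof.
case: s => [|x f]; first by rewrite ltn0 andbF.
move=> xf /andP[ij js].
by apply: (sorted_ltn_nth (@cwltb_trans x)) => //; rewrite inE (ltn_trans ij).
Qed.

Definition cyclic_edge (H : {set {set 'I_n}}) s :=
  cyc_sorted s && ([set x in s] \in H).

Lemma cyclic_edge_rot1 H s : cyclic_edge H s -> cyclic_edge H (rot 1 s).
Proof.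
move=> /andP[/cyc_sorted_rot1 ss sH]; rewrite /cyclic_edge ss.
have -> // : [set x in rot 1 s] = [set x in s].
by apply/setP => x; rewrite !inE mem_rot.
Qed.

End ClockwiseOrder.

Section CountingCyclicTuples.
Variable n : nat.
Implicit Types (e : {set 'I_n}) (H : {set {set 'I_n}}).

Lemma card_pointed_edges r H : uniform_cgh r H ->
  #|[set ex : {set 'I_n} * 'I_n | (ex.1 \in H) && (ex.2 \in ex.1)]| = #|H| * r.
Proof.
move=> Hr; rewrite -sum1dep_card.
rewrite -(pair_big_dep (mem H) (fun e => mem e) (fun _ _ => 1)) /=.
by rewrite -sum_nat_const; apply: eq_bigr => e /Hr <-; rewrite sum1_card.
Qed.

Lemma cyc_sorted_enum e x : x \in e ->
  exists s, [/\ cyc_sorted (x :: s), x :: s =i e & (size s).+1 = #|e|].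
Proof.
move=> xe; pose s := sort (relpre (cwdist x) leq) (enum e).
have ss : sorted (cwltb x) s.
  rewrite -sorted_map ltn_sorted_uniq_leq (map_inj_uniq (@cwdist_inj n x)).
  rewrite sort_uniq enum_uniq /= sorted_map sort_sorted // => y z.
  exact: leq_total.
have se : s =i e by move=> y; rewrite mem_sort mem_enum.
have sz : size s = #|e| by rewrite size_sort -cardE.
move: xe; rewrite -se; case: s ss se sz => [//|y s] ss se sz.
rewrite inE => /predU1P[xy|xs]; first by exists s; rewrite xy in ss *.
have := order_path_min (@cwltb_trans _ x) ss => /allP/(_ _ xs).
by rewrite /cwltb /= cwdistxx.
Qed.

Lemma cyc_sorted_inj r : {in [pred t : r.+1.-tuple 'I_n | cyc_sorted t] &,
  injective (fun t => ([set x in t], thead t))}.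
Proof.
move=> t t'; rewrite !inE => ts t's [/setP ett' hd]; apply: val_inj.
have mem_tt' : t =i t' by move=> x; have := ett' x; rewrite !inE.
move: ts t's hd mem_tt'; case/tupleP: t {ett'} => x f; case/tupleP: t' => x' f'.
rewrite !theadE => xf x'f' xx'; rewrite {}xx' in xf * => ff'.
exact: (irr_sorted_eq (@cwltb_trans _ x') (@cwltb_irr _ x')).
Qed.

Lemma card_cyclic_edges r H : uniform_cgh r.+1 H ->
  #|[set t : r.+1.-tuple 'I_n | cyclic_edge H t]| = #|H| * r.+1.
Proof.
move=> Hr; rewrite -(card_pointed_edges Hr).
pose pointed (t : r.+1.-tuple 'I_n) := ([set x in t], thead t).
rewrite -(card_in_imset (f := pointed)).
  congr #|pred_of_set _|; apply/setP => -[e x]; rewrite inE /=.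
  apply/imsetP/andP => [[t + [-> ->]]|[eH xe]].
    by rewrite !inE => /andP[_ ->]; rewrite mem_tnth.
  have [s [sc se sz]] := cyc_sorted_enum xe.
  have szr : size (x :: s) == r.+1 by rewrite /= sz Hr.
  have setE : [set y in Tuple szr] = e by apply/setP => y; rewrite inE se.
  by exists (Tuple szr); rewrite /pointed ?inE /cyclic_edge setE ?sc ?eH.
move=> t t'; rewrite !inE => /andP[ts _] /andP[t's _].
exact: cyc_sorted_inj.
Qed.

Lemma card_cyc_sorted q : 0 < q ->
  #|[set t : q.-tuple 'I_n | cyc_sorted t]| = q * 'C(n, q).
Proof.
case: q => // q _; pose D := [set e : {set 'I_n} | #|e| == q.+1].
have Dq : uniform_cgh q.+1 D by move=> e; rewrite inE => /eqP.
rewrite mulnC -[n in 'C(n, _)]card_ord -card_draws -/D -(card_cyclic_edges Dq).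
apply: eq_card => t; rewrite !inE /cyclic_edge.
case: (boolP (cyc_sorted t)) => //= ts; rewrite inE cardsE.
rewrite -[X in _ == X](size_tuple t); apply/esym/eqP/card_uniqP.
case/tupleP: t ts => x f.
exact: (sorted_uniq (@cwltb_trans _ x) (@cwltb_irr _ x)).
Qed.

End CountingCyclicTuples.

Section Arcs.
Variables (n : nat) (b : 'I_n).

Definition arc l u : {set 'I_n} := [set x | l <= cwdist b x < u].

Lemma segment_from_arc a u :
  cwdist b a < u <= n -> segment_from a (arc (cwdist b a) u).
Proof.
move=> /andP[au un]; exists (u - cwdist b a); first by lia.
apply/setP => x; rewrite !inE (cwdist_rebase b a x).
by have := ltn_cwdist b x; case: (leqP (cwdist b a)); lia.
Qed.

Lemma segments_in_order_arcs r (L : nat -> nat) (a : 'I_r -> 'I_n) :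
  {homo L : i j / i <= j} -> (forall j : 'I_r, L j < L j.+1) -> L r <= n ->
  (forall j, cwdist b (a j) = L j) ->
  segments_in_order a (fun j => arc (L j) (L j.+1)).
Proof.
move=> Lhomo Lstep Ln aL; split.
- move=> j; rewrite -aL; apply: segment_from_arc.
  by rewrite aL Lstep (leq_trans _ Ln) // Lhomo.
- move=> i j; rewrite -val_eqE /= neq_ltn => ij; apply/pred0P => x /=.
  rewrite !inE; apply/negP => /andP[/andP[Li iL] /andP[Lj jL]].
  by case/orP: ij => /Lhomo; lia.
- move=> o i j o0 ij x y; rewrite !inE => /andP[Li iL] /andP[Lj _].
  have [Lo Lij] : L o <= L i /\ L i.+1 <= L j by rewrite !Lhomo ?o0.
  rewrite -[cwlt _ _ _]/(is_true (cwltb (a o) x y)) (cwltb_rebase (b := b)) ?aL.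
  + by rewrite /cwltb /=; lia.
  + exact: leq_trans Li.
  + by lia.
Qed.

End Arcs.

Section OrderedClasses.
Variables (n k r : nat) (b : 'I_n) (v : nat -> 'I_n).
Let N := k + r - 1.
Hypotheses (k_gt0 : 0 < k) (r_gt0 : 0 < r).
Hypothesis classes_ordered :
  forall i j, i < N -> j < N -> i %% r < j %% r -> cwltb b (v i) (v j).
Hypothesis class_monotone :
  forall i, i + r < N -> cwltb_alt (odd (i %% r)) b (v i) (v (i + r)).

Lemma same_class_lt i j : i < j < N -> i %% r = j %% r ->
  cwltb_alt (odd (i %% r)) b (v i) (v j).
Proof.
move=> /andP[ij jN] eij; have ijr : i %/ r < j %/ r.
  move: ij; rewrite {1}(divn_eq i r) {1}(divn_eq j r) eij.
  by rewrite ltn_add2r ltn_pmul2r.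
rewrite (divn_eq i r) (divn_eq j r) -eij modnMDl modn_mod.
pose D := [pred d | d * r + i %% r < N].
pose alt x y := cwltb_alt (odd (i %% r)) b x y.
apply: (homo_ltn_in (f := fun d => v (d * r + i %% r)) (r := alt) (D := D)).
- by move=> y x z; apply: cwltb_alt_trans.
- move=> d d' _ + d'' /andP[_ /ltnW d''d']; rewrite !inE; apply: leq_ltn_trans.
  by rewrite leq_add2r leq_mul2r d''d' orbT.
- move=> d _; rewrite inE mulSn -addnA addnC => dN.
  by have := class_monotone dN; rewrite modnMDl modn_mod.
- by rewrite inE -divn_eq (ltn_trans ij).
- by rewrite inE eij -divn_eq.
- exact: ijr.
Qed.

Lemma classes_inj i j : i < N -> j < N -> v i = v j -> i = j.
Proof.
move=> iN jN vij; have [e|e|e] := ltngtP (i %% r) (j %% r).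
- by have := classes_ordered iN jN e; rewrite vij cwltb_irr.
- by have := classes_ordered jN iN e; rewrite vij cwltb_irr.
have [ij|ij|//] := ltngtP i j.
  have : i < j < N by rewrite ij.
  by move=> /same_class_lt/(_ e); rewrite vij cwltb_alt_irr.
have : j < i < N by rewrite ij.
by move=> /same_class_lt/(_ (esym e)); rewrite vij cwltb_alt_irr.
Qed.

(* The j-th segment starts just after the last point of the earlier classes. *)
Definition class_bound j := \max_(i < N | i %% r < j) (cwdist b (v i)).+1.

Lemma class_bound_homo : {homo class_bound : i j / i <= j}.
Proof.
move=> i j ij; apply/bigmax_leqP => l li.
by apply: (leq_bigmax_cond (F := fun l : 'I_N => _)); apply: leq_trans ij.
Qed.

Lemma mem_class_arc i :
  i < N -> v i \in arc b (class_bound (i %% r)) (class_bound (i %% r).+1).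
Proof.
move=> iN; rewrite inE; apply/andP; split.
  by apply/bigmax_leqP => l li; apply: classes_ordered.
exact: (leq_bigmax_cond (F := fun l : 'I_N => _) (Ordinal iN)).
Qed.

Lemma zigzag_of_ordered_classes (H : {set {set 'I_n}}) :
  (forall i, i < k -> [set v (i + t) | t : 'I_r] \in H) -> zigzag r k H v.
Proof.
move=> vH; split; first by split; first exact: classes_inj.
have bound_lt (j : 'I_r) : class_bound j < class_bound j.+1.
  have jN : j < N by have := ltn_ord j; rewrite /N; lia.
  have := mem_class_arc jN; rewrite inE modn_small //.
  by move=> /andP[]; apply: leq_ltn_trans.
have bound_n j : class_bound j <= n.
  by apply/bigmax_leqP => i _; apply: ltn_cwdist.
have /fin_all_exists[a aL] (j : 'I_r) : exists x, cwdist b x = class_bound j.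
  exact: cwdist_surj (leq_trans (bound_lt j) (bound_n _)).
have alt_rebase (j : 'I_r) i : i + r < N -> i %% r = j ->
    cwltb_alt (odd j) (a j) (v i) (v (i + r)).
  move=> iN ij; have := class_monotone iN; rewrite ij.
  have := mem_class_arc (leq_ltn_trans (leq_addr r i) iN).
  have := mem_class_arc iN; rewrite modnDr ij !inE => /andP[ir _] /andP[i0 _].
  by rewrite /cwltb_alt !(cwltb_rebase (b := b) (a := a j)) ?aL.
exists a, (fun j : 'I_r => arc b (class_bound j) (class_bound j.+1)); split.
- exact: segments_in_order_arcs class_bound_homo bound_lt (bound_n r) aL.
- by move=> j i iN <-; apply: mem_class_arc.
- move=> j i iN ij j_even.
  by have := alt_rebase _ _ iN ij; rewrite (negbTE j_even).
- by move=> j i iN ij j_odd; have := alt_rebase _ _ iN ij; rewrite j_odd.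
Qed.

End OrderedClasses.

Section ClassIndex.
Variable r : nat.
Hypothesis r_gt0 : 0 < r.

(* The index congruent to c modulo r in the window m, ..., m + r - 1. *)
Definition class_index m c := m + (c + (r - m %% r)) %% r.

Lemma class_index_bounds m c : m <= class_index m c < m + r.
Proof. by rewrite leq_addr ltn_add2l ltn_mod. Qed.

Lemma class_index_mod m c : c < r -> class_index m c %% r = c.
Proof.
move=> cr; rewrite modnDmr -modnDml addnCA subnKC ?(ltnW (ltn_pmod _ _)) //.
by rewrite modnDr modn_small.
Qed.

Lemma class_index_unique m i : m <= i < m + r -> class_index m (i %% r) = i.
Proof.
move=> /andP[mi imr]; have := class_index_mod m (ltn_pmod i r_gt0).
have /andP[] := class_index_bounds m (i %% r).
move: mi imr => /subnKC <-; move: (i - m) => s; rewrite ltn_add2l => sr.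
move=> /subnKC <-; move: (_ - m) => t; rewrite ltn_add2l => tr /eqP.
by rewrite eqn_modDl !modn_small // => /eqP->.
Qed.

Lemma class_indexS m c : c < r ->
  class_index m.+1 c = if c == m %% r then m + r else class_index m c.
Proof.
move=> cr; have /andP[mi imr] := class_index_bounds m c.
have ic := class_index_mod m cr; case: eqP => [->|/eqP cm].
  by rewrite -(modnDr m) class_index_unique //; lia.
rewrite -{1}ic class_index_unique // addSn ltnS (ltnW imr) andbT ltn_neqAle mi.
by rewrite andbT; apply: contraNneq cm => {1}->; rewrite ic.
Qed.

End ClassIndex.

(* Two neighbouring tracks can be compared at the later of the two times if they
   move towards each other, and at the earlier one if they move apart. *)
Lemma alternating_tracks_lt r k (f : nat -> nat -> nat) :
  (forall m c, m < k -> c.+1 < r -> f m c < f m c.+1) ->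
  (forall m c, m.+1 < k -> c < r ->
     if odd c then f m.+1 c <= f m c else f m c <= f m.+1 c) ->
  forall m m' c c', m < k -> m' < k -> c < c' < r -> f m c < f m' c'.
Proof.
move=> f_lt f_step.
have gtn_convex : {in gtn k &, forall i j l, i < l < j -> l \in gtn k}.
  by move=> i j _ jk l /andP[_ /ltn_trans]; apply.
have up c m m' : c < r -> ~~ odd c -> m <= m' -> m' < k -> f m c <= f m' c.
  move=> cr c_even mm' m'k.
  apply: (homo_leq_in (f := f^~ c) leqnn leq_trans gtn_convex) => //;
    last exact: leq_ltn_trans m'k.
  by move=> i _ ik; have := f_step _ _ ik cr; rewrite (negbTE c_even).
have down c m m' : c < r -> odd c -> m <= m' -> m' < k -> f m' c <= f m c.
  move=> cr c_odd mm' m'k.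
  apply: (homo_leq_in (f := f^~ c) (r := fun x y => y <= x) leqnn _ gtn_convex)
    => //.
  - by move=> y x z xy yz; apply: leq_trans yz xy.
  - by move=> i _ ik; have := f_step _ _ ik cr; rewrite c_odd.
  - exact: leq_ltn_trans m'k.
have adjacent c m m' : c.+1 < r -> m < k -> m' < k -> f m c < f m' c.+1.
  move=> cr mk m'k; have c0r := ltnW cr.
  have [c_odd|c_even] := boolP (odd c).
    have Mk : minn m m' < k by rewrite gtn_min mk.
    apply: leq_ltn_trans (down _ _ _ c0r c_odd (geq_minl m m') mk) _.
    apply: leq_trans (f_lt _ _ Mk cr) (up _ _ _ cr _ (geq_minr m m') m'k).
    by rewrite /= c_odd.
  have Mk : maxn m m' < k by rewrite gtn_max mk.
  apply: leq_ltn_trans (up _ _ _ c0r c_even (leq_maxl m m') Mk) _.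
  exact: leq_trans (f_lt _ _ Mk cr) (down _ _ _ cr c_even (leq_maxr m m') Mk).
move=> m m' c c' mk m'k; elim: c' => [|c' IHc]; first by rewrite ltn0.
rewrite ltnS leq_eqVlt => /andP[/predU1P[->|cc'] c'r]; first exact: adjacent.
apply: ltn_trans (IHc _) (f_lt _ _ m'k c'r).
by rewrite cc' ltnW.
Qed.

Definition window T r (v : nat -> T) i := mkseq (fun t => v (i + t)) r.

Lemma window_rcons T r (v : nat -> T) i :
  window r.+1 v i = rcons (window r v i) (v (i + r)).
Proof. exact: mkseqS. Qed.

Lemma window_cons T r (v : nat -> T) i :
  window r.+1 v i = v i :: window r v i.+1.
Proof.
rewrite /window /mkseq /= addn0 (iotaDl 1 0) -map_comp; congr (_ :: _).
by apply: eq_map => t /=; rewrite addnA addn1.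
Qed.

Lemma eq_window T r (v v' : nat -> T) i :
  (forall j, i <= j < i + r -> v j = v' j) -> window r v i = window r v' i.
Proof.
move=> vv'; apply/eq_in_map => t; rewrite mem_iota => tr.
by apply: vv'; rewrite leq_addr ltn_add2l.
Qed.

Lemma cyc_sorted_window n r (v : nat -> 'I_n) i s t :
  cyc_sorted (window r v i) -> s < t < r -> cwltb (v i) (v (i + s)) (v (i + t)).
Proof.
move=> vi /andP[st tr]; have := @cyc_sorted_nth _ (v i) _ s t vi.
rewrite size_mkseq st tr !nth_mkseq ?addn0 //; last 2 first.
- exact: ltn_trans tr.
- exact: leq_ltn_trans tr.
exact.
Qed.

Lemma set_window n r (v : nat -> 'I_n) i :
  [set x in window r v i] = [set v (i + t) | t : 'I_r].
Proof.
apply/setP => x; rewrite inE; apply/mapP/imsetP => [[t]|[t _ ->]].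
  by rewrite mem_iota => tr ->; exists (Ordinal (tr : t < r)).
by exists (t : nat) => //; rewrite mem_iota ltn_ord.
Qed.

Section ZigzagWalks.
Variables (n q : nat) (H : {set {set 'I_n}}).

Definition zigzag_walk k (v : nat -> 'I_n) :=
  (forall i, i < k -> cyclic_edge H (window q.+1 v i)) /\
  (forall i, i.+1 < k ->
     cwltb_alt (odd i) (v (i + q)) (v i) (v (i + q.+1))).

Lemma zigzag_walk_extend k v y : zigzag_walk k.+1 v ->
  let s := rcons (window q v k.+1) y in
  cyclic_edge H s -> cwltb_alt (odd k) (v (k + q)) (v k) y ->
  exists2 v', zigzag_walk k.+2 v' & window q.+1 v' k.+1 = s.
Proof.
move=> [windows turns] s sH turn; pose v' := [eta v with k + q.+1 |-> y].
have v'y : v' (k + q.+1) = y by rewrite /= eqxx.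
have v'v i : i < k + q.+1 -> v' i = v i by move=> /ltn_eqF /= ->.
have last_window : window q.+1 v' k.+1 = s.
  rewrite window_rcons addSnnS v'y (@eq_window _ _ v' v) // => i /andP[_ ik].
  by rewrite v'v // -addSnnS.
exists v' => //; split=> i; rewrite ltnS leq_eqVlt => /predU1P[].
- by move=> ->; rewrite last_window.
- move=> ik; rewrite (@eq_window _ _ v' v) ?windows // => j /andP[_ ji].
  by rewrite v'v // (leq_trans ji) // leq_add2r.
- by move=> [->]; rewrite v'y !v'v //; lia.
- by move=> ik; rewrite !v'v; [exact: turns | lia..].
Qed.

Hypothesis q_odd : odd q.
Let r := q.+1.
Variables (k : nat) (v : nat -> 'I_n).
Hypotheses (k_gt0 : 0 < k) (walk_v : zigzag_walk k v).

Let q_gt0 : 0 < q. Proof. by case: q q_odd. Qed.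

Let odd_class i : odd (i %% r) = odd i.
Proof. by rewrite odd_mod //= q_odd. Qed.

Definition position m c := cwdist (v 0) (v (class_index r m c)).

Lemma positionS m c : c < r -> position m.+1 c =
  if c == m %% r then cwdist (v 0) (v (m + r)) else position m c.
Proof. by move=> cr; rewrite /position class_indexS //; case: eqP. Qed.

Lemma position_index m i c : m <= i < m + r -> i %% r = c ->
  position m c = cwdist (v 0) (v i).
Proof. by move=> im <-; rewrite /position class_index_unique. Qed.

Lemma position_mod m : position m (m %% r) = cwdist (v 0) (v m).
Proof. by apply: position_index; lia. Qed.

Lemma position_mod_pred m :
  0 < m %% r -> position m (m %% r).-1 = cwdist (v 0) (v (m + q)).
Proof.
move=> c_gt0; apply: position_index; first by rewrite leq_addr ltn_add2l leqnn.
rewrite -modnDml -{1}(prednK c_gt0) addSnnS modnDr modn_small //.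
by rewrite (leq_ltn_trans (leq_pred _)) ?ltn_pmod.
Qed.

Lemma position_mod_succ m :
  (m %% r).+1 < r -> position m (m %% r).+1 = cwdist (v 0) (v m.+1).
Proof.
move=> cr; apply: position_index; first by rewrite leqnSn -addn1 ltn_add2l.
by rewrite -addn1 -modnDml addn1 modn_small.
Qed.

Definition moves_between_neighbours m :=
  let c := m %% r in let d := cwdist (v 0) (v (m + r)) in
  if odd c then position m c.-1 < d < position m c
  else position m c < d < position m c.+1.

Lemma moves_between_neighbours_of_sorted m : m.+1 < k ->
  (forall c, c.+1 < r -> position m c < position m c.+1) ->
  moves_between_neighbours m.
Proof.
move=> mk sorted_m; have [windows turns] := walk_v.
have cr : m %% r < r by rewrite ltn_mod.
have new_last : cwltb (v m.+1) (v (m + q)) (v (m + r)).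
  have /andP[win _] := windows _ mk.
  have := cyc_sorted_window (s := q.-1) (t := q) win; rewrite prednK // !leqnn.
  by rewrite addSnnS prednK // addSnnS => ->.
have := turns _ mk; rewrite /moves_between_neighbours odd_class position_mod.
rewrite /cwltb_alt; case: ifP => m_odd turn.
  have c_gt0 : 0 < m %% r by move: m_odd; rewrite -odd_class; case: (m %% r).
  have := sorted_m (m %% r).-1; rewrite prednK // position_mod.
  rewrite position_mod_pred // => /(_ cr) old_after_pred.
  apply: cwltb_retreat old_after_pred _ turn.
  by apply: contraTneq new_last => ->; rewrite cwltb_irr.
have succ_lt : (m %% r).+1 < r.
  rewrite ltn_neqAle cr andbT; apply: contraFneq m_odd => -[cq].
  by rewrite -odd_class cq.
have := sorted_m _ succ_lt; rewrite position_mod position_mod_succ //.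
by move=> old_before_succ; apply: cwltb_advance old_before_succ new_last turn.
Qed.

Lemma position_lt m c : m < k -> c.+1 < r -> position m c < position m c.+1.
Proof.
elim: m c => [|m IHm] c mk cr.
  have [windows _] := walk_v; have /andP[win _] := windows _ k_gt0.
  rewrite (@position_index 0 c) ?modn_small ?(ltnW cr) //.
  rewrite (@position_index 0 c.+1) ?modn_small //.
  by apply: (cyc_sorted_window win); rewrite leqnn.
have sorted_m c' : c'.+1 < r -> _ := IHm c' (ltnW mk).
have := moves_between_neighbours_of_sorted mk sorted_m.
rewrite /moves_between_neighbours !positionS ?(ltnW cr) //.
have [cm|cm] := eqVneq c (m %% r); have [cSm|cSm] := eqVneq c.+1 (m %% r).
- by lia.
- rewrite -cm; case: ifP => _ /andP[] // _ /ltn_trans -> //.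
  exact: sorted_m.
- rewrite -cSm; case: ifP => _ /andP[] // /(ltn_trans _) -> //.
  exact: sorted_m.
- by move=> _; apply: sorted_m.
Qed.

Lemma walk_moves_between_neighbours m :
  m.+1 < k -> moves_between_neighbours m.
Proof.
move=> mk; apply: moves_between_neighbours_of_sorted => // c.
exact: position_lt (ltnW mk).
Qed.

Lemma position_step m c : m.+1 < k -> c < r ->
  if odd c then position m.+1 c <= position m c
  else position m c <= position m.+1 c.
Proof.
move=> mk cr; rewrite positionS //; case: eqP => [->|_]; last by case: ifP.
have := walk_moves_between_neighbours mk; rewrite /moves_between_neighbours.
by case: ifP => _ /andP[lt gt]; apply: ltnW.
Qed.

Lemma zigzag_of_walk : zigzag r k H v.
Proof.
have [windows _] := walk_v.
have index_window i : i < k + r - 1 -> i - q < k /\ i - q <= i < i - q + r.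
  by rewrite /r; lia.
apply: (@zigzag_of_ordered_classes _ _ _ (v 0)) => //
  [i j iN jN cij|i irN|i ik].
- have [[ik iw] [jk jw]] := (index_window i iN, index_window j jN).
  rewrite /cwltb /= -(position_index iw erefl) -(position_index jw erefl).
  apply: (alternating_tracks_lt position_lt position_step) => //.
  by rewrite cij ltn_pmod.
- have ik : i.+1 < k by lia.
  have := walk_moves_between_neighbours ik.
  rewrite /moves_between_neighbours position_mod /cwltb_alt.
  by case: ifP => _ /andP[].
- by rewrite -set_window; have /andP[] := windows i ik.
Qed.

End ZigzagWalks.

Lemma card_le_dominated_imset (T U : finType) (lt : rel T) (g : T -> U)
    (A : {set T}) :
  {in A &, forall t t', g t = g t' -> t != t' -> lt t t' || lt t' t} ->
  #|A| <= #|[set t in A | [exists t' in A, lt t' t]]| + #|g @: A|.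
Proof.
move=> lt_fiber; set D := finset _.
have DA : D \subset A by apply/subsetP => t; rewrite inE => /andP[].
rewrite -(cardsID D A) (setIidPr DA) leq_add2l.
rewrite -(card_in_imset (f := g) (D := A :\: D)).
  exact/subset_leq_card/imsetS/subsetDl.
move=> t t'; rewrite !inE => /andP[+ tA] /andP[+ t'A] gtt'; rewrite tA t'A /=.
move=> /existsPn/(_ t') + /existsPn/(_ t); rewrite tA t'A /=.
have [//|tt' /negPf not_lt' /negPf not_lt] := eqVneq t t'.
by have := lt_fiber _ _ tA t'A gtt' tt'; rewrite not_lt not_lt'.
Qed.

Section WalkEnds.
Variables (n q : nat) (H : {set {set 'I_n}}).
Hypothesis q_gt0 : 0 < q.
Implicit Types t : q.+1.-tuple 'I_n.

(* Tuples with the same tail mark points of the same gap of that tail, which is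
   traversed clockwise from the last point of the tail. *)
Definition gap_lt rev t' t := (behead t' == behead t) &&
  cwltb_alt rev (last (thead t) t) (thead t') (thead t).

(* If t' is the end of a walk and precedes t in their gap, then the first point
   of t prolongs that walk, and the new end is t with the mark passed on. *)
Fixpoint walk_ends m : {set q.+1.-tuple 'I_n} :=
  if m is m'.+1 then
    [set [tuple of rot 1 t] | t : q.+1.-tuple 'I_n in
       [set t in walk_ends m' |
          [exists t' in walk_ends m', gap_lt (odd m') t' t]]]
  else [set t : q.+1.-tuple 'I_n | cyclic_edge H t].

Lemma walk_ends_edge m t : t \in walk_ends m -> cyclic_edge H t.
Proof.
elim: m t => [t|m IHm _ /imsetP[t + ->]]; first by rewrite inE.
by rewrite inE => /andP[/IHm tH _]; apply: cyclic_edge_rot1.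
Qed.

Lemma last_behead_eq t t' : behead t = behead t' ->
  last (thead t) t = last (thead t') t'.
Proof.
case/tupleP: t => x f; case/tupleP: t' => y f' /= ->.
by case: f' => -[] //=; case: q q_gt0.
Qed.

Lemma gap_lt_total rev t t' :
  behead t = behead t' -> t != t' -> gap_lt rev t t' || gap_lt rev t' t.
Proof.
move=> bb tt'; rewrite /gap_lt bb eqxx (last_behead_eq bb) /=.
apply: cwltb_alt_total; apply: contraNneq tt' => hh; apply/eqP/val_inj.
by rewrite (tuple_eta t) (tuple_eta t') /= hh bb.
Qed.

Lemma card_walk_endsS m :
  #|walk_ends m| <= #|walk_ends m.+1| + q * 'C(n, q).
Proof.
pose gap t : q.-tuple 'I_n := [tuple of behead t].
have gap_total : {in walk_ends m &, forall t t', gap t = gap t' -> t != t' ->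
    gap_lt (odd m) t t' || gap_lt (odd m) t' t}.
  by move=> t t' _ _ /(congr1 val) /gap_lt_total; apply.
apply: leq_trans (card_le_dominated_imset gap_total) (leq_add _ _).
  by rewrite /= card_imset // => t t' /(congr1 val) /rot_inj /val_inj.
rewrite -card_cyc_sorted //.
apply/subset_leq_card/subsetP => _ /imsetP[t tm ->].
by have /andP[ts _] := walk_ends_edge tm; rewrite inE cyc_sorted_behead.
Qed.

Lemma card_walk_ends m :
  #|walk_ends 0| <= #|walk_ends m| + m * (q * 'C(n, q)).
Proof.
elim: m => [|m IHm]; first by rewrite mul0n addn0.
apply: leq_trans IHm _; rewrite mulSn addnA leq_add2r.
exact: card_walk_endsS.
Qed.

Lemma walk_endsP m t : t \in walk_ends m ->
  exists2 v, zigzag_walk q H m.+1 v & window q.+1 v m = t.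
Proof.
elim: m t => [|m IHm] t tm; have := walk_ends_edge tm.
  have tE : window q.+1 (nth (thead t) t) 0 = t.
    by rewrite /window -[in RHS](mkseq_nth (thead t) t) size_tuple.
  by exists (nth (thead t) t) => //; split=> // -[|//] _; rewrite tE.
case/imsetP: tm => u + ->; rewrite inE => /andP[um /exists_inP[u' u'm]].
case/andP=> /eqP bb turn; have [v walk_v vu'] := IHm _ u'm.
have rotE : rot 1 u = rcons (window q v m.+1) (thead u).
  by rewrite [in LHS](tuple_eta u) /= rot1_cons -bb -vu' window_cons.
rewrite /= rotE; move/zigzag_walk_extend; apply=> //.
move: turn; rewrite -(last_behead_eq bb) -vu'.
have -> : thead u' = v m by rewrite /thead (tnth_nth (v 0)) -vu' window_cons.
by rewrite window_rcons last_rcons.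
Qed.

End WalkEnds.

Lemma zigzag_free_card (n k r : nat) (H : {set {set 'I_n}}) :
  0 < k -> 1 < r -> ~~ odd r -> uniform_cgh r H -> zigzag_free r k H ->
  #|H| * r <= k.-1 * (r.-1 * 'C(n, r.-1)).
Proof.
case: r k => // q [//|k] _ q_gt0 /negPn q_odd Hq free.
rewrite -(card_cyclic_edges Hq) /=.
apply: leq_trans (card_walk_ends H q_gt0 k) _.
rewrite -[leqRHS]add0n leq_add2r leqn0 cards_eq0.
apply: contra_notT free => /set0Pn[t /(walk_endsP q_gt0)[v walk_v _]].
by exists v; apply: zigzag_of_walk walk_v.
Qed.

Local Open Scope ring_scope.

Theorem theorem1p5 (n k r : nat)
    (hn : (1 <= n)%N) (hk : (1 <= k)%N) (hr : (2 <= r)%N) (hr_even : ~~ odd r) :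
  (forall H : {set {set 'I_n}}, uniform_cgh r H -> zigzag_free r k H ->
     #|H|%:R <= (k%:R - 1) * (r%:R - 1) / r%:R * 'C(n, r - 1)%:R :> rat) /\
  (ex_zigzag n r k)%:R
    <= (k%:R - 1) * (r%:R - 1) / r%:R * 'C(n, r - 1)%:R :> rat.
Proof.
have boundE c :
    (c%:R <= (k%:R - 1) * (r%:R - 1) / r%:R * 'C(n, r - 1)%:R :> rat)
      = (c * r <= k.-1 * (r.-1 * 'C(n, r.-1)))%N.
  have r_gt0 : (0 : rat) < r%:R by rewrite ltr0n ltnW.
  have natr_pred m : (0 < m)%N -> m%:R - 1 = m.-1%:R :> rat.
    by move=> m_gt0; rewrite -subn1 natrB.
  rewrite subn1 !natr_pred ?(ltnW hr) // mulrAC ler_pdivlMr //.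
  by rewrite -!natrM ler_nat mulnA.
split=> [H Hr free|]; rewrite boundE; first exact: zigzag_free_card.
apply: (big_ind (fun c => c * r <= _)%N) => // [c d cr dr|H /asboolP[Hr free]].
  by rewrite /maxn; case: ifP.
exact: zigzag_free_card.
Qed.
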